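(* There exists a closed homogeneous ideal $J\subset\mathfrak{A}_\infty$ such that $J\subsetneq I(V(J))$.
   Context: Here $\infty$ stands for $d=\aleph_0$, with index set $\Lambda=\{1,2,3,\dots\}$. Let $M_n(\mathbb{C})^\infty$ be the set of sequences $T=(T_i)_{i\ge1}$ of $n\times n$ matrices defining a bounded row operator $\bigoplus_{i\ge1}\mathbb{C}^n\to\mathbb{C}^n$, and let $\|T\|$ be the norm of this row operator. The nc open unit ball is $\mathfrak{B}_\infty=\bigsqcup_{n\ge1}\{T\in M_n(\mathbb{C})^\infty:\|T\|<1\}$. An nc function on $\mathfrak{B}_\infty$ is a map $f$ sending $n\times n$ tuples to $n\times n$ matrices, with $f(T\oplus U)=f(T)\oplus f(U)$ and $f(R^{-1}TR)=R^{-1}f(T)R$ whenever $R$ is an invertible matrix and $T,R^{-1}TR\in\mathfrak{B}_\infty$. It is uniformly continuous if for every $\epsilon>0$ there is $\delta>0$ such that for all $n$ and all $T,U\in\mathfrak{B}_\infty$ of size $n$, $\|T-U\|<\delta$ implies $\|f(T)-f(U)\|<\epsilon$. $A_\infty$ is the algebra of uniformly continuous nc functions on $\mathfrak{B}_\infty$ with the supremum norm; it equals the norm closure of the free polynomials in the coordinate functions $z_i(T)=T_i$. It is known to be completely isometrically isomorphic, via $L_i\mapsto z_i$, to the noncommutative disc algebra $\mathfrak{A}_\infty$, i.e. the norm closed unital algebra generated by the left creation operators $L_i\xi=e_i\otimes\xi$ on the full Fock space $\bigoplus_nH^{\otimes n}$, where $H$ is a Hilbert space with orthonormal basis $(e_i)_{i\ge1}$;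 the two algebras are identified. Every $f\in A_\infty$ has $n$-homogeneous components $f_n(T)=\frac1{2\pi}\int_0^{2\pi}f(e^{i\theta}T)e^{-in\theta}\,d\theta$. A (two-sided) ideal $J$ is homogeneous if $f\in J$ implies $f_n\in J$ for all $n\ge0$. Define $V(J)=\{T\in\mathfrak{B}_\infty:f(T)=0\text{ for all }f\in J\}$, and for $\Omega\subseteq\mathfrak{B}_\infty$, $I(\Omega)=\{f\in A_\infty:f(T)=0\text{ for all }T\in\Omega\}$. *)

(* Defs.v *)
From HB Require Import structures.
From mathcomp Require Import all_boot all_order all_algebra.
From mathcomp Require Import all_classical all_reals all_analysis.
From mathcomp Require Import complex.

Set Implicit Arguments.
Unset Strict Implicit.
Unset Printing Implicit Defensive.

Import Order.TTheory GRing.Theory Num.Theory.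
Import numFieldNormedType.Exports.

Local Open Scope classical_set_scope.
Local Open Scope ring_scope.
Local Open Scope complex_scope.

(* The complex numbers are R[i] for an arbitrary R : realType.  Sequences are
   indexed by nat, so the index i here is i + 1 in the index set {1, 2, ...}. *)

Definition l2norm (R : realType) (n : nat) (x : 'cV[R[i]]_n) : R :=
  Num.sqrt (\sum_i Normc.normc (x i 0) ^+ 2).

Definition opnorm (R : realType) (n : nat) (A : 'M[R[i]]_n) : \bar R :=
  ereal_sup [set (l2norm (A *m x))%:E | x in [set x | l2norm x <= 1]].

(* The norm of the row operator (x_i) |-> \sum_i T_i x_i on the l^2 direct sum
   of copies of C^n, computed on the dense subspace of finitely supported
   vectors; T defines a bounded row operator iff it is < +oo. *)
Definition row_norm (R : realType) (n : nat) (T : nat -> 'M[R[i]]_n) : \bar R :=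
  ereal_sup [set (l2norm (\sum_(i < Nx.1) T i *m Nx.2 i))%:E |
    Nx in [set Nx : nat * (nat -> 'cV[R[i]]_n) |
            \sum_(i < Nx.1) l2norm (Nx.2 i) ^+ 2 <= 1]].

(* Level n of the nc open unit ball; it is empty for n = 0. *)
Record nc_ball (R : realType) (n : nat) := NCBall {
  nc_tuple :> nat -> 'M[R[i]]_n;
  nc_size_gt0 : (0 < n)%N;
  nc_row_norm_lt1 : (row_norm nc_tuple < 1)%E
}.

Definition nc_map (R : realType) := forall n : nat, nc_ball R n -> 'M[R[i]]_n.

Definition nc_direct_sum (R : realType) (f : nc_map R) : Prop :=
  forall (n m : nat) (T : nc_ball R n) (U : nc_ball R m) (W : nc_ball R (n + m)%N),
    (forall i, W i = block_mx (T i) 0 0 (U i)) ->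
    f _ W = block_mx (f _ T) 0 0 (f _ U).

Definition nc_similarity (R : realType) (f : nc_map R) : Prop :=
  forall (n : nat) (S : 'M[R[i]]_n) (T U : nc_ball R n),
    S \in unitmx -> (forall i, U i = invmx S *m T i *m S) ->
    f _ U = invmx S *m f _ T *m S.

Definition nc_function (R : realType) (f : nc_map R) : Prop :=
  nc_direct_sum f /\ nc_similarity f.

Definition nc_unif_continuous (R : realType) (f : nc_map R) : Prop :=
  forall e : R, 0 < e -> exists2 d : R, 0 < d &
    forall (n : nat) (T U : nc_ball R n),
      (row_norm (fun i => T i - U i)%R < d%:E)%E ->
      (opnorm (f _ T - f _ U)%R < e%:E)%E.

Definition A_infty (R : realType) : set (nc_map R) :=
  [set f | nc_function f /\ nc_unif_continuous f].

Definition nc_zero (R : realType) : nc_map R := fun n _ => 0.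
Definition nc_add (R : realType) (f g : nc_map R) : nc_map R :=
  fun n T => f n T + g n T.
Definition nc_sub (R : realType) (f g : nc_map R) : nc_map R :=
  fun n T => f n T - g n T.
Definition nc_scale (R : realType) (c : R[i]) (f : nc_map R) : nc_map R :=
  fun n T => c *: f n T.
Definition nc_mul (R : realType) (f g : nc_map R) : nc_map R :=
  fun n T => f n T *m g n T.

Definition sup_norm (R : realType) (f : nc_map R) : \bar R :=
  ereal_sup [set y | exists (n : nat) (T : nc_ball R n), y = opnorm (f n T)].

Record nc_ideal (R : realType) (J : set (nc_map R)) : Prop := NCIdeal {
  nc_ideal_sub : J `<=` @A_infty R;
  nc_ideal0 : J (@nc_zero R);
  nc_idealD : forall f g, J f -> J g -> J (nc_add f g);
  nc_idealZ : forall c f, J f -> J (nc_scale c f);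
  nc_idealMl : forall a f, A_infty a -> J f -> J (nc_mul a f);
  nc_idealMr : forall a f, A_infty a -> J f -> J (nc_mul f a)
}.

Definition nc_closed (R : realType) (J : set (nc_map R)) : Prop :=
  forall f : nc_map R, A_infty f ->
    (forall e : R, 0 < e -> exists2 g, J g & (sup_norm (nc_sub f g) < e%:E)%E) ->
    J f.

Definition expi (R : realType) (t : R) : R[i] := cos t +i* sin t.

Lemma normc_expi (R : realType) (t : R) : Normc.normc (expi t) = 1.
Proof. by rewrite /Normc.normc /= cos2Dsin2 sqrtr1. Qed.

Lemma l2norm_expi (R : realType) (n : nat) (t : R) (x : 'cV[R[i]]_n) :
  l2norm (expi t *: x) = l2norm x.
Proof.
congr Num.sqrt; apply: eq_bigr => i _.
by rewrite mxE Normc.normcM normc_expi mul1r.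
Qed.

Lemma row_norm_expi (R : realType) (n : nat) (t : R) (T : nat -> 'M[R[i]]_n) :
  (row_norm (fun i => expi t *: T i)%R <= row_norm T)%E.
Proof.
apply: ge_ereal_sup => _ [[N x] /= xle1 <-]; apply: ereal_sup_ubound.
exists (N, x) => //=.
rewrite -[in RHS](eq_bigr _ (fun _ _ => scalemxAl _ _ _)) -scaler_sumr.
by rewrite l2norm_expi.
Qed.

Lemma row_norm_expi_lt1 (R : realType) (n : nat) (t : R) (T : nc_ball R n) :
  (row_norm (fun i => expi t *: T i)%R < 1)%E.
Proof. exact: le_lt_trans (row_norm_expi t T) (nc_row_norm_lt1 T). Qed.

Definition nc_rotate (R : realType) (n : nat) (t : R) (T : nc_ball R n) :
    nc_ball R n :=
  NCBall (nc_size_gt0 T) (row_norm_expi_lt1 t T).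

Definition cintegral (R : realType) (D : set R) (g : R -> R[i]) : R[i] :=
  (\int[@lebesgue_measure R]_(t in D) complex.Re (g t)) +i*
  (\int[@lebesgue_measure R]_(t in D) complex.Im (g t)).

(* The matrix-valued integral defining f_k is taken entrywise. *)
Definition nc_component (R : realType) (f : nc_map R) (k : nat) : nc_map R :=
  fun n T => \matrix_(i, j)
    (((2 * pi)^-1)%:C *
     cintegral `[0, 2 * pi]
       (fun t => f n (nc_rotate t T) i j * expi (- (k%:R * t)))).

Definition nc_homogeneous (R : realType) (J : set (nc_map R)) : Prop :=
  forall f, J f -> forall k : nat, J (nc_component f k).

Definition nc_subset (R : realType) := forall n : nat, set (nc_ball R n).

Definition zero_locus (R : realType) (J : set (nc_map R)) : nc_subset R :=
  fun n => [set T | forall f, J f -> f n T = 0].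

Definition vanishing_ideal (R : realType) (Om : nc_subset R) : set (nc_map R) :=
  [set f | A_infty f /\ forall (n : nat) (T : nc_ball R n), Om n T -> f n T = 0].

(* Main.v *)
Require Import Defs.
From HB Require Import structures.
From mathcomp Require Import all_boot all_order all_algebra.
From mathcomp Require Import all_classical all_reals all_analysis.
From mathcomp Require Import complex ring lra.

(** Write x_i = z_(2i) and y_i = z_(2i+1).  The idea is to exploit the gap
    between square summable and summable sequences.  Consider the relations

      x_0 y_0 = (i + 1) x_i y_i        for all i >= 0.

    For a row contraction T of n x n matrices, with components X_i and Y_i,
    the entries at any fixed position are square summable over i
    ([row_bound_entries]). An entry of X_i Y_i is a sum of n products of such
    entries; since n is finite, it is summable over i. If T satisfies the
    relations, then this entry is that of X_0 Y_0 divided by i + 1, and the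
    harmonic series diverges, so X_0 Y_0 = 0 ([path_product_vanishes]). Hence
    x_0 y_0 vanishes on the zero locus of any ideal that contains the
    relations.

    On the other hand, 1 / (i + 1) is square summable.  Therefore pairing the
    quadratic part of f with the vector that has coefficient 1 / (i + 1) at
    x_i y_i is a bounded functional.  It annihilates the relations and is
    nonzero at x_0 y_0, so that x_0 y_0 is not even in the closed ideal
    generated by the relations.

    To read off this functional without a Fock space, f is evaluated at nilpotent
    tuples W_N of size N + 2 ([witness]): paths of length 2 from the vertex 0 to the
    vertex N + 1, through N intermediate vertices, one for each i < N, with
    product of weights proportional to 1 / (i + 1).  Their row norms are at most
    1/2 for all N.  The ideal J ([corner_ideal]) consists of those f for which
    f(W_N) is supported in its upper right corner, with a corner entry that tends
    to 0 as N grows.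

    - J is a two-sided ideal because nc functions respect intertwining relations
      ([nc_function_intertwine]): the first basis vector is killed by W_N, so it
      is an eigenvector of a(W_N) for the eigenvalue a(0), and dually for the last
      coordinate ([mul_corner], [corner_mul]).
    - J is closed because each entry of f(W_N) is bounded by the norm of f.
    - J is homogeneous because rotating W_N by e^(it) is the conjugation by a
      diagonal matrix, which multiplies the corner entry by e^(2it)
      ([corner_values_rotate]); averaging multiplies it by a constant that does not
      depend on N.

    Two analytic facts about the function algebra are needed on the way.
    It is closed under products, since its members are bounded
    ([A_infty_bounded]); and it contains the homogeneous components of its
    members, since entrywise integrals of matrices satisfy a norm inequality that
    does not depend on the size ([mx_mean_op_bound]). *)

Set Implicit Arguments.
Unset Strict Implicit.
Unset Printing Implicit Defensive.

Import Order.TTheory GRing.Theory Num.Theory.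
Import numFieldNormedType.Exports.

Local Open Scope classical_set_scope.
Local Open Scope ring_scope.
Local Open Scope complex_scope.

Local Notation normc := Normc.normc.

(** * The modulus on the complex numbers and the Euclidean norm *)

Section Vectors.
Context {R : realType}.
Implicit Types (z w : R[i]) (n : nat).

(** Cauchy-Schwarz, from the nonnegativity of the sum of the
    (B a_i - p b_i)^2, where p is the left-hand sum and B the sum of the
    b_i^2. *)
Lemma sum_mul_sqr_le (I : finType) (P : pred I) (a b : I -> R) :
  (\sum_(i | P i) a i * b i) ^+ 2 <=
  (\sum_(i | P i) a i ^+ 2) * (\sum_(i | P i) b i ^+ 2).
Proof.
set p := \sum_(i | P i) a i * b i.
set A := \sum_(i | P i) a i ^+ 2; set B := \sum_(i | P i) b i ^+ 2.
have B0 : 0 <= B by apply: sumr_ge0 => i _; exact: sqr_ge0.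
have [B_eq0|Bn0] := eqVneq B 0.
  rewrite /p big1 ?expr0n ?B_eq0 ?mulr0// => i Pi.
  have /eqP : b i ^+ 2 = 0.
    by have /psumr_eq0P := B_eq0; apply => // j _; exact: sqr_ge0.
  by rewrite sqrf_eq0 => /eqP ->; rewrite mulr0.
have Bgt0 : 0 < B by rewrite lt_def Bn0.
have expand (c d : R) : \sum_(i | P i) (c * a i - d * b i) ^+ 2 =
    c ^+ 2 * A - 2 * c * d * p + d ^+ 2 * B.
  by rewrite !mulr_sumr -sumrB -big_split /=; apply: eq_bigr => i _; ring.
have : 0 <= \sum_(i | P i) (B * a i - p * b i) ^+ 2.
  by apply: sumr_ge0 => i _; exact: sqr_ge0.
have -> : \sum_(i | P i) (B * a i - p * b i) ^+ 2 = B * (A * B - p ^+ 2).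
  by rewrite expand; ring.
by rewrite pmulr_rge0// subr_ge0.
Qed.

Lemma normc_ge0 z : 0 <= normc z.
Proof. by case: z => a b; exact: sqrtr_ge0. Qed.

Lemma normcD z w : normc (z + w) <= normc z + normc w.
Proof. by have := ler_normD z w; rewrite -[X in _ <= X]rmorphD lecR. Qed.

Lemma normc_real (r : R) : normc r%:C = `|r|.
Proof. by rewrite /normc /= expr0n addr0 sqrtr_sqr. Qed.

Lemma normc_sqr z : normc z ^+ 2 = complex.Re z ^+ 2 + complex.Im z ^+ 2.
Proof. by case: z => a b; rewrite sqr_sqrtr // addr_ge0 ?sqr_ge0. Qed.

Lemma normc_Re z : `|complex.Re z| <= normc z.
Proof.
by rewrite -ler_sqr ?nnegrE ?normc_ge0// real_normK ?num_real// normc_sqr lerDl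
  sqr_ge0.
Qed.

Lemma normc_Im z : `|complex.Im z| <= normc z.
Proof.
by rewrite -ler_sqr ?nnegrE ?normc_ge0// real_normK ?num_real// normc_sqr lerDr
  sqr_ge0.
Qed.

Lemma normc_sum (I : Type) (r : seq I) (P : pred I) (F : I -> R[i]) :
  normc (\sum_(i <- r | P i) F i) <= \sum_(i <- r | P i) normc (F i).
Proof.
elim/big_rec2: _ => [|i y1 y2 _ IH]; first by rewrite Normc.normc0.
by rewrite (le_trans (normcD _ _))// lerD2l.
Qed.

Lemma l2norm_ge0 n (x : 'cV[R[i]]_n) : 0 <= l2norm x.
Proof. exact: sqrtr_ge0. Qed.

Lemma l2norm_sqr n (x : 'cV[R[i]]_n) :
  l2norm x ^+ 2 = \sum_i normc (x i 0) ^+ 2.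
Proof. by rewrite sqr_sqrtr// sumr_ge0// => i _; exact: sqr_ge0. Qed.

Lemma l2norm0 n : l2norm (0 : 'cV[R[i]]_n) = 0.
Proof.
by rewrite /l2norm big1 ?sqrtr0// => i _; rewrite mxE Normc.normc0 expr0n.
Qed.

Lemma l2normZ n (c : R[i]) (x : 'cV[R[i]]_n) : l2norm (c *: x) = normc c * l2norm x.
Proof.
apply/eqP; rewrite -(@eqrXn2 _ 2)// ?mulr_ge0 ?l2norm_ge0 ?normc_ge0//.
rewrite exprMn !l2norm_sqr mulr_sumr; apply/eqP; apply: eq_bigr => i _.
by rewrite mxE Normc.normcM exprMn.
Qed.

Lemma l2norm_eq0 n (x : 'cV[R[i]]_n) : l2norm x = 0 -> x = 0.
Proof.
move=> x0; apply/matrixP => i j; rewrite ord1 mxE.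
have /eqP := l2norm_sqr x; rewrite x0 expr0n /= eq_sym psumr_eq0; last first.
  by move=> k _; exact: sqr_ge0.
move=> /allP /(_ i); rewrite mem_index_enum => /(_ isT) /=.
by rewrite sqrf_eq0 => /eqP /Normc.eq0_normc.
Qed.

Lemma l2normD n (x y : 'cV[R[i]]_n) : l2norm (x + y) <= l2norm x + l2norm y.
Proof.
rewrite -ler_sqr ?nnegrE ?addr_ge0 ?l2norm_ge0//.
rewrite sqrrD !l2norm_sqr.
set a := fun i => normc (x i 0); set b := fun i => normc (y i 0).
apply: (@le_trans _ _ (\sum_i (a i + b i) ^+ 2)).
  apply: ler_sum => i _; rewrite ler_sqr ?nnegrE ?addr_ge0 ?normc_ge0//.
  by rewrite mxE normcD.
have -> : \sum_i (a i + b i) ^+ 2 =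
    \sum_i a i ^+ 2 + (\sum_i a i * b i) *+ 2 + \sum_i b i ^+ 2.
  by rewrite -sumrMnl -!big_split /=; apply: eq_bigr => i _; rewrite sqrrD.
rewrite lerD2r lerD2l lerMn2r /= -ler_sqr ?nnegrE ?mulr_ge0 ?l2norm_ge0//.
  by rewrite exprMn !l2norm_sqr; exact: sum_mul_sqr_le.
by apply: sumr_ge0 => i _; rewrite mulr_ge0 ?normc_ge0.
Qed.

Lemma normc_le_l2norm n (x : 'cV[R[i]]_n) i : normc (x i 0) <= l2norm x.
Proof.
rewrite -ler_sqr ?nnegrE ?normc_ge0 ?l2norm_ge0// l2norm_sqr (bigD1 i)//= lerDl.
by apply: sumr_ge0 => j _; exact: sqr_ge0.
Qed.

Lemma l2norm_delta n (i : 'I_n) : l2norm (delta_mx i 0 : 'cV[R[i]]_n) = 1.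
Proof.
rewrite /l2norm (bigD1 i)//= big1 ?addr0.
  by rewrite mxE !eqxx mulr1n Normc.normc1 expr1n sqrtr1.
by move=> j /negPf ji; rewrite mxE ji andFb mulr0n Normc.normc0 expr0n.
Qed.

Lemma l2norm_col_mx n m (x : 'cV[R[i]]_n) (y : 'cV[R[i]]_m) :
  l2norm (col_mx x y) ^+ 2 = l2norm x ^+ 2 + l2norm y ^+ 2.
Proof.
rewrite !l2norm_sqr big_split_ord /=; congr (_ + _).
  by apply: eq_bigr => i _; rewrite col_mxEu.
by apply: eq_bigr => i _; rewrite col_mxEd.
Qed.

End Vectors.

(** * Operator bounds and row bounds *)

Section Bounds.
Context {R : realType}.
Implicit Types n m : nat.

(** Both [opnorm] and [row_norm] are suprema of a homogeneous function F over the
    unit ball of a homogeneous function G.  Abstracting the rescaling as [sc]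
    handles both at once: V is a type of vectors in one case, of finitely
    supported sequences of vectors in the other. *)
Lemma sup_unit_ball_lt (V : Type) (sc : R -> V -> V) (F G : V -> R) (e : R) :
  inhabited V -> (forall v, 0 <= G v) -> (forall v, G v = 0 -> F v = 0) ->
  (forall c v, 0 <= c -> F (sc c v) = c * F v) ->
  (forall c v, 0 <= c -> G (sc c v) = c * G v) ->
  (ereal_sup [set (F v)%:E | v in [set v | (G v <= 1)%R]] < e%:E)%E <->
  (exists2 r, 0 <= r < e & forall v, F v <= r * G v).
Proof.
move=> [v0] G0 FG FZ GZ; split.
  set s := ereal_sup _ => s_lt.
  have s_ge0 : (0 <= s)%E.
    apply: ereal_sup_ubound; exists (sc 0 v0); rewrite /= ?FZ ?GZ ?mul0r//.
  have s_fin : s \is a fin_num.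
    by rewrite ge0_fin_numE// (lt_le_trans s_lt)// leey.
  exists (fine s).
    by rewrite fine_ge0//= -lte_fin fineK.
  move=> v; have [Gv0|Gvn0] := eqVneq (G v) 0.
    by rewrite FG// Gv0 mulr0.
  have Gvgt0 : 0 < G v by rewrite lt_def Gvn0 G0.
  have Gi : 0 <= (G v)^-1 by rewrite invr_ge0.
  rewrite -ler_pdivrMr// mulrC -FZ// -lee_fin fineK//.
  apply: ereal_sup_ubound; exists (sc (G v)^-1 v) => //=.
  by rewrite GZ// mulVf.
move=> [r /andP[r0 re] FGr]; apply: (@le_lt_trans _ _ r%:E); last by rewrite lte_fin.
apply: ge_ereal_sup => _ [v /= Gv <-]; rewrite lee_fin (le_trans (FGr v))//.
by rewrite ler_piMr.
Qed.

(** Extended-real suprema are replaced by inequalities with a real constant,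
    which combine by plain arithmetic. *)
Definition op_bound n (A : 'M[R[i]]_n) (r : R) : Prop :=
  forall x, l2norm (A *m x) <= r * l2norm x.

Lemma opnorm_ltP n (A : 'M[R[i]]_n) (e : R) :
  (opnorm A < e%:E)%E <-> (exists2 r, 0 <= r < e & op_bound A r).
Proof.
apply: (@sup_unit_ball_lt _ (fun c x => c%:C *: x)).
- exact: (inhabits 0).
- by move=> x; exact: l2norm_ge0.
- by move=> x /l2norm_eq0 ->; rewrite mulmx0 l2norm0.
- by move=> c x c0; rewrite -scalemxAr l2normZ normc_real ger0_norm.
- by move=> c x c0; rewrite l2normZ normc_real ger0_norm.
Qed.

Definition seq_norm n (N : nat) (x : nat -> 'cV[R[i]]_n) : R :=
  Num.sqrt (\sum_(i < N) l2norm (x i) ^+ 2).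

Lemma seq_norm_ge0 n N (x : nat -> 'cV[R[i]]_n) : 0 <= seq_norm N x.
Proof. exact: sqrtr_ge0. Qed.

Lemma seq_norm_sqr n N (x : nat -> 'cV[R[i]]_n) :
  seq_norm N x ^+ 2 = \sum_(i < N) l2norm (x i) ^+ 2.
Proof. by rewrite sqr_sqrtr// sumr_ge0// => i _; exact: sqr_ge0. Qed.

Definition row_bound n (T : nat -> 'M[R[i]]_n) (r : R) : Prop :=
  forall N (x : nat -> 'cV_n), l2norm (\sum_(i < N) T i *m x i) <= r * seq_norm N x.

Lemma row_bound_sqr n (T : nat -> 'M[R[i]]_n) (r : R) : 0 <= r ->
  row_bound T r <-> forall N (x : nat -> 'cV_n),
    l2norm (\sum_(i < N) T i *m x i) ^+ 2 <=
    r ^+ 2 * \sum_(i < N) l2norm (x i) ^+ 2.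
Proof.
move=> r0; split=> H N x; have := H N x; rewrite -seq_norm_sqr -exprMn.
  by rewrite ler_sqr ?nnegrE ?l2norm_ge0 ?mulr_ge0 ?seq_norm_ge0.
by rewrite ler_sqr ?nnegrE ?l2norm_ge0 ?mulr_ge0 ?seq_norm_ge0.
Qed.

Lemma row_norm_ltP n (T : nat -> 'M[R[i]]_n) (e : R) :
  (row_norm T < e%:E)%E <-> (exists2 r, 0 <= r < e & row_bound T r).
Proof.
pose V := (nat * (nat -> 'cV[R[i]]_n))%type.
have -> : row_norm T = ereal_sup [set (l2norm (\sum_(i < v.1) T i *m v.2 i))%:E |
    v in [set v : V | seq_norm v.1 v.2 <= 1]].
  congr ereal_sup; congr image; apply/seteqP; split=> v /=;
    by rewrite -seq_norm_sqr expr_le1 ?seq_norm_ge0.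
have -> : row_bound T = fun r => forall v : V,
    l2norm (\sum_(i < v.1) T i *m v.2 i) <= r * seq_norm v.1 v.2.
  apply/funext => r; apply/propext; split=> [H [N x]|H N x]; first exact: H.
  exact: (H (N, x)).
apply: (@sup_unit_ball_lt V (fun c v => (v.1, fun i => c%:C *: v.2 i)) _
  (fun v => seq_norm v.1 v.2)).
- by apply: inhabits; exact: (0%N, fun=> 0).
- by move=> v; exact: seq_norm_ge0.
- move=> [N x] /= xN0; rewrite big1 ?l2norm0// => i _.
  have /eqP := seq_norm_sqr N x; rewrite xN0 expr0n /= eq_sym psumr_eq0; last first.
    by move=> k _; exact: sqr_ge0.
  move=> /allP /(_ i); rewrite mem_index_enum => /(_ isT) /=.
  by rewrite sqrf_eq0 => /eqP /l2norm_eq0 ->; rewrite mulmx0.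
- move=> c [N x] c0 /=; under eq_bigr do rewrite -scalemxAr.
  by rewrite -scaler_sumr l2normZ normc_real ger0_norm.
- move=> c [N x] c0 /=; apply/eqP.
  rewrite -(@eqrXn2 _ 2)// ?mulr_ge0 ?seq_norm_ge0// exprMn !seq_norm_sqr mulr_sumr.
  by apply/eqP/eq_bigr => i _; rewrite l2normZ normc_real ger0_norm// exprMn.
Qed.

Lemma op_boundW n (A : 'M[R[i]]_n) (r s : R) : op_bound A r -> r <= s -> op_bound A s.
Proof. by move=> H rs x; rewrite (le_trans (H x))// ler_wpM2r ?l2norm_ge0. Qed.

Lemma op_boundD n (A B : 'M[R[i]]_n) (r s : R) :
  op_bound A r -> op_bound B s -> op_bound (A + B) (r + s).
Proof.
move=> Ar Bs x; rewrite mulmxDl mulrDl (le_trans (l2normD _ _))//.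
by apply: lerD; [exact: Ar|exact: Bs].
Qed.

Lemma op_boundM n (A B : 'M[R[i]]_n) (r s : R) : 0 <= r ->
  op_bound A r -> op_bound B s -> op_bound (A *m B) (r * s).
Proof.
move=> r0 Ar Bs x; rewrite -mulmxA (le_trans (Ar _))// -mulrA ler_wpM2l//.
Qed.

Lemma op_boundZ n (A : 'M[R[i]]_n) (c : R[i]) (r : R) :
  op_bound A r -> op_bound (c *: A) (normc c * r).
Proof.
by move=> Ar x; rewrite -scalemxAl l2normZ -mulrA ler_wpM2l ?normc_ge0.
Qed.

Lemma normc_le_op_bound n (A : 'M[R[i]]_n) (r : R) p q :
  op_bound A r -> normc (A p q) <= r.
Proof.
move=> /(_ (delta_mx q 0)); rewrite l2norm_delta mulr1 -colE.
by apply: le_trans; have := normc_le_l2norm (col q A) p; rewrite mxE.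
Qed.

Lemma row_boundW n (T : nat -> 'M[R[i]]_n) (r s : R) :
  row_bound T r -> r <= s -> row_bound T s.
Proof. by move=> H rs N x; rewrite (le_trans (H N x))// ler_wpM2r ?seq_norm_ge0. Qed.

Lemma row_boundZ n (T : nat -> 'M[R[i]]_n) (c : R[i]) (r : R) :
  row_bound T r -> row_bound (fun i => c *: T i) (normc c * r).
Proof.
move=> Tr N x; under eq_bigr do rewrite -scalemxAl.
by rewrite -scaler_sumr l2normZ -mulrA ler_wpM2l ?normc_ge0.
Qed.

Lemma op_bound_coord n (T : nat -> 'M[R[i]]_n) (r : R) k :
  row_bound T r -> op_bound (T k) r.
Proof.
move=> Tr x; have := Tr k.+1 (fun i => if i == k then x else 0).
rewrite /seq_norm !big_ord_recr /= eqxx !big1 ?add0r.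
- by rewrite sqrtr_sqr ger0_norm ?l2norm_ge0.
- by move=> i _; rewrite ltn_eqF// l2norm0 expr0n.
- by move=> i _; rewrite ltn_eqF// mulmx0.
Qed.

Lemma row_bound_direct_sum n m (T : nat -> 'M[R[i]]_n) (U : nat -> 'M[R[i]]_m) (r : R) :
  0 <= r -> row_bound T r -> row_bound U r ->
  row_bound (fun i => block_mx (T i) 0 0 (U i)) r.
Proof.
move=> r0 /(row_bound_sqr _ r0) Tr /(row_bound_sqr _ r0) Ur.
apply/(row_bound_sqr _ r0) => N x.
have -> : \sum_(i < N) block_mx (T i) 0 0 (U i) *m x i =
    col_mx (\sum_(i < N) T i *m usubmx (x i)) (\sum_(i < N) U i *m dsubmx (x i)).
  elim/big_rec3: _ => [|i y1 y2 y3 _ ->]; first by rewrite col_mx0.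
  rewrite -[x i in LHS]vsubmxK mul_block_col !mul0mx addr0 add0r add_col_mx.
  by [].
rewrite l2norm_col_mx (le_trans (lerD (Tr _ (fun i => usubmx (x i)))
  (Ur _ (fun i => dsubmx (x i)))))// -mulrDr -big_split /=.
rewrite ler_wpM2l ?sqr_ge0// ler_sum// => i _.
by rewrite -l2norm_col_mx vsubmxK.
Qed.

(** The row operator maps e_(co i) in the i-th summand to b_i e_(ro i).  Summands
    aimed at different coordinates have orthogonal images, so by Cauchy-Schwarz
    only the weights aimed at one and the same coordinate have to be square
    summable. *)
Lemma row_bound_delta n (b : nat -> R) (ro co : nat -> 'I_n) (r : R) : 0 <= r ->
  (forall p N, \sum_(i < N | ro i == p) b i ^+ 2 <= r ^+ 2) ->
  row_bound (fun i => (b i)%:C *: delta_mx (ro i) (co i)) r.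
Proof.
move=> r0 br; apply/(row_bound_sqr _ r0) => N x.
pose y i := normc (x i (co i) 0).
have entry p : normc ((\sum_(i < N) (b i)%:C *: delta_mx (ro i) (co i) *m x i) p 0)
    <= \sum_(i < N | ro i == p) `|b i| * y i.
  rewrite summxE [X in _ <= X]big_mkcond /=; apply: (le_trans (normc_sum _ _ _)).
  apply: ler_sum => i _; rewrite -scalemxAl mxE Normc.normcM normc_real mxE.
  rewrite (bigD1 (co i))//= big1; last first.
    by move=> j /negPf ji; rewrite mxE ji andbF mul0r.
  rewrite mxE eqxx andbT addr0 Normc.normcM eq_sym; case: eqP => _.
    by rewrite Normc.normc1 mul1r.
  by rewrite Normc.normc0 mul0r mulr0.
rewrite l2norm_sqr.
apply: (@le_trans _ _ (\sum_p r ^+ 2 * \sum_(i < N | ro i == p) y i ^+ 2)).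
  apply: ler_sum => p _.
  apply: (@le_trans _ _ ((\sum_(i < N | ro i == p) `|b i| * y i) ^+ 2)).
    rewrite ler_sqr ?nnegrE ?normc_ge0//.
    by apply: sumr_ge0 => i _; rewrite mulr_ge0 ?normc_ge0.
  apply: (le_trans (sum_mul_sqr_le _ _ _)); rewrite ler_wpM2r//.
    by apply: sumr_ge0 => i _; exact: sqr_ge0.
  by under eq_bigr do rewrite real_normK ?num_real//.
rewrite -mulr_sumr ler_wpM2l ?sqr_ge0//.
have -> : \sum_p \sum_(i < N | ro i == p) y i ^+ 2 = \sum_(i < N) y i ^+ 2.
  by rewrite [RHS](partition_big (fun i : 'I_N => ro i) xpredT).
apply: ler_sum => i _; rewrite ler_sqr ?nnegrE ?normc_ge0 ?l2norm_ge0//.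
exact: normc_le_l2norm.
Qed.

End Bounds.

(** * The nc ball and its uniformly continuous nc functions *)

Section Ball.
Context {R : realType}.
Implicit Types (n m : nat) (f g : nc_map R).

Lemma nc_ball_bound n (T : nc_ball R n) : exists2 r : R, 0 <= r < 1 & row_bound T r.
Proof. exact/row_norm_ltP/nc_row_norm_lt1. Qed.

Lemma nc_ball_of_bound n (T : nat -> 'M[R[i]]_n) (r : R) :
  (0 < n)%N -> 0 <= r < 1 -> row_bound T r -> exists U : nc_ball R n, U =1 T.
Proof.
move=> n0 r01 Tr; have T1 : (row_norm T < 1)%E by apply/row_norm_ltP; exists r.
by exists (NCBall n0 T1).
Qed.

Lemma nc_direct_sum_exists n m (T : nc_ball R n) (U : nc_ball R m) :
  exists W : nc_ball R (n + m), forall i, W i = block_mx (T i) 0 0 (U i).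
Proof.
have [r /andP[r0 r1] Tr] := nc_ball_bound T.
have [s /andP[s0 s1] Us] := nc_ball_bound U.
apply: (@nc_ball_of_bound _ _ (Num.max r s)).
- by rewrite addn_gt0 (nc_size_gt0 T).
- by rewrite le_max r0 /= gt_max r1.
apply: row_bound_direct_sum; first by rewrite le_max r0.
- by apply: row_boundW Tr _; rewrite le_max lexx.
- by apply: row_boundW Us _; rewrite le_max lexx orbT.
Qed.

(** Nc functions respect all intertwining relations, not only similarities: if
    T X = X U, then the unipotent block matrix with off-diagonal block X commutes
    with the direct sum of T and U, hence with its image under f. *)
Lemma nc_function_intertwine f n m (T : nc_ball R n) (U : nc_ball R m)
    (X : 'M[R[i]]_(n, m)) :
  nc_function f -> (forall i, T i *m X = X *m U i) -> f n T *m X = X *m f m U.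
Proof.
move=> [fsum fsim] TX; have [W WE] := nc_direct_sum_exists T U.
pose S : 'M[R[i]]_(n + m) := block_mx 1%:M X 0 1%:M.
have Su : S \in unitmx by rewrite unitmxE det_ublock !det1 mulr1 unitr1.
have SW i : W i = invmx S *m W i *m S.
  rewrite -mulmxA; have -> : W i *m S = S *m W i.
    rewrite WE !mulmx_block !mulmx0 !mul0mx !mulmx1 !mul1mx !addr0 !add0r.
    by rewrite TX.
  by rewrite mulmxA mulVmx// mul1mx.
have := fsim _ S W W Su SW => /(congr1 (mulmx S)).
rewrite !mulmxA mulmxV// mul1mx (fsum _ _ T U W WE).
rewrite !mulmx_block !mulmx0 !mul0mx !mulmx1 !mul1mx !addr0 !add0r.
by move=> /eq_block_mx[_ ->].
Qed.

Lemma zero_ball_exists n : (0 < n)%N -> exists T : nc_ball R n, forall i, T i = 0.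
Proof.
move=> n0; apply: (@nc_ball_of_bound _ (fun=> 0) 0) => //.
  by rewrite lexx ltr01.
by move=> N x; rewrite mul0r big1 ?l2norm0// => i _; rewrite mul0mx.
Qed.

Definition zero_ball n (n0 : (0 < n)%N) : nc_ball R n :=
  projT1 (cid (zero_ball_exists n0)).

Lemma zero_ballE n (n0 : (0 < n)%N) i : zero_ball n0 i = 0.
Proof. by rewrite /zero_ball; case: cid. Qed.

(** The constant term of f. *)
Definition value0 f : R[i] := f 1 (zero_ball (ltn0Sn 0)) 0 0.

(** A vector killed by T intertwines T with the zero tuple of size 1. *)
Lemma nc_function_kernel f n (T : nc_ball R n) (v : 'cV[R[i]]_n) :
  nc_function f -> (forall i, T i *m v = 0) -> f n T *m v = value0 f *: v.
Proof.
move=> fnc Tv.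
rewrite (@nc_function_intertwine f n 1 T (zero_ball (ltn0Sn 0)) v)//; last first.
  by move=> i; rewrite Tv zero_ballE mulmx0.
by rewrite [f 1 _]mx11_scalar mul_mx_scalar.
Qed.

Lemma nc_function_cokernel f n (T : nc_ball R n) (u : 'rV[R[i]]_n) :
  nc_function f -> (forall i, u *m T i = 0) -> u *m f n T = value0 f *: u.
Proof.
move=> fnc uT.
rewrite -(@nc_function_intertwine f 1 n (zero_ball (ltn0Sn 0)) T u)//; last first.
  by move=> i; rewrite uT zero_ballE mul0mx.
by rewrite [f 1 _]mx11_scalar mul_scalar_mx.
Qed.

Lemma nc_unif_continuousP f : nc_unif_continuous f <->
  forall e : R, 0 < e -> exists2 d : R, 0 < d &
    forall n (T U : nc_ball R n) (r : R), 0 <= r < d ->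
      row_bound (fun i => T i - U i) r -> op_bound (f n T - f n U) e.
Proof.
split=> fuc e e0.
  have [d d0 fd] := fuc e e0; exists d => // n T U r rd TUr.
  have /opnorm_ltP[s /andP[s0 se] H] : (opnorm (f n T - f n U)%R < e%:E)%E.
    by apply: fd; apply/row_norm_ltP; exists r.
  by apply: op_boundW H _; exact: ltW.
have e20 : 0 < e / 2 by rewrite divr_gt0.
have [d d0 fd] := fuc _ e20; exists d => // n T U /row_norm_ltP[r rd TUr].
apply/opnorm_ltP; exists (e / 2); last exact: fd rd TUr.
by rewrite (ltW e20) /= gtr_pMr// invf_lt1// ltr1n.
Qed.

(** Join 0 to T by K + 1 equal steps, short enough for each to change f by at most
    1; their number does not depend on T.  At the zero tuple f is the scalar
    [value0 f]. *)
Lemma A_infty_bounded f : A_infty f ->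
  exists2 C : R, 0 <= C & forall n (T : nc_ball R n), op_bound (f n T) C.
Proof.
move=> [fnc /nc_unif_continuousP fuc]; have [d d0 fd] := fuc 1 ltr01.
have [K Kd] : exists K : nat, K.+1%:R^-1 < d.
  exists (Num.truncn d^-1); rewrite invf_plt ?posrE//.
  exact: Num.Theory.truncnS_gt.
have K0 : 0 < K.+1%:R :> R by rewrite ltr0n.
exists (normc (value0 f) + K.+1%:R).
  by rewrite addr_ge0 ?normc_ge0// ltW.
move=> n T; have [r /andP[r0 r1] Tr] := nc_ball_bound T.
have scaled (k : nat) : (k <= K.+1)%N ->
    exists U : nc_ball R n, forall i, U i = (k%:R / K.+1%:R)%:C *: T i.
  move=> kK; have kK1 : k%:R / K.+1%:R <= 1 :> R.
    by rewrite ler_pdivrMr// mul1r ler_nat.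
  apply: (@nc_ball_of_bound _ _ r) => //; rewrite ?(nc_size_gt0 T) ?r0//.
  apply: row_boundW (row_boundZ _ Tr) _.
  by rewrite normc_real ger0_norm ?divr_ge0 ?ler0n// ler_piMl.
suff step k : (k <= K.+1)%N -> forall U : nc_ball R n,
    (forall i, U i = (k%:R / K.+1%:R)%:C *: T i) ->
    op_bound (f n U) (normc (value0 f) + k%:R).
  by apply: (step K.+1) => // i; rewrite divff ?gt_eqF// scale1r.
elim: k => [_|k IH kK] U UE.
  move=> x; rewrite nc_function_kernel// ?l2normZ ?addr0//.
  by move=> i; rewrite UE mul0r scale0r mul0mx.
have [V VE] := scaled _ (ltnW kK).
have -> : f n U = f n V + (f n U - f n V) by rewrite addrCA subrr addr0.
rewrite -natr1 (addrA (normc _)).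
apply: op_boundD; first exact: IH (ltnW kK) _ VE.
apply: (fd _ _ _ (K.+1%:R^-1)); first by rewrite invr_ge0 ltW.
have -> : (fun i => U i - V i) = (fun i => (K.+1%:R^-1)%:C *: T i).
  apply/funext => i; rewrite UE VE -scalerBl -rmorphB; congr (_%:C *: _).
  by rewrite -mulrBl -natr1 addrAC subrr add0r mul1r.
apply: row_boundW (row_boundZ _ Tr) _.
by rewrite normc_real ger0_norm ?invr_ge0 ?ler0n// ler_piMr ?invr_ge0 ?ler0n//;
  exact: ltW.
Qed.

Lemma A_infty_zero : A_infty (@nc_zero R).
Proof.
split; first split.
- by move=> n m T U W _; rewrite /nc_zero -[LHS]block_mx0.
- by move=> n S T U _ _; rewrite /nc_zero mulmx0 mul0mx.
apply/nc_unif_continuousP => e e0; exists 1 => // n T U r _ _ x.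
by rewrite /nc_zero subr0 mul0mx l2norm0 mulr_ge0 ?l2norm_ge0 ?ltW.
Qed.

Lemma A_infty_add f g : A_infty f -> A_infty g -> A_infty (nc_add f g).
Proof.
move=> [[fs ft] /nc_unif_continuousP fu] [[gs gt] /nc_unif_continuousP gu].
split; first split.
- move=> n m T U W WE; rewrite /nc_add (fs _ _ _ _ _ WE) (gs _ _ _ _ _ WE).
  by rewrite add_block_mx !addr0.
- move=> n S T U Su UE; rewrite /nc_add (ft _ _ _ _ Su UE) (gt _ _ _ _ Su UE).
  by rewrite mulmxDr mulmxDl.
apply/nc_unif_continuousP => e e0.
have e20 : 0 < e / 2 by rewrite divr_gt0.
have [d1 d10 fd] := fu _ e20; have [d2 d20 gd] := gu _ e20.
exists (Num.min d1 d2); first by rewrite lt_min d10.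
move=> n T U r /andP[r0]; rewrite lt_min => /andP[r1 r2] TU.
rewrite [e]splitr /nc_add opprD addrACA.
by apply: op_boundD; [apply: fd TU; rewrite r0|apply: gd TU; rewrite r0].
Qed.

Lemma A_infty_mul f g : A_infty f -> A_infty g -> A_infty (nc_mul f g).
Proof.
move=> Af Ag; have [Cf Cf0 fC] := A_infty_bounded Af.
have [Cg Cg0 gC] := A_infty_bounded Ag; case: Af Ag.
move=> [fs ft] /nc_unif_continuousP fu [[gs gt] /nc_unif_continuousP gu].
split; first split.
- move=> n m T U W WE; rewrite /nc_mul (fs _ _ _ _ _ WE) (gs _ _ _ _ _ WE).
  by rewrite mulmx_block !mulmx0 !mul0mx !addr0 !add0r.
- move=> n S T U Su UE; rewrite /nc_mul (ft _ _ _ _ Su UE) (gt _ _ _ _ Su UE).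
  by rewrite !mulmxA mulmxK.
apply/nc_unif_continuousP => e e0.
have CC : 0 < Cf + Cg + 1 by rewrite ltr_wpDl ?addr_ge0.
pose e1 := e / (Cf + Cg + 1); have e10 : 0 < e1 by rewrite divr_gt0.
have [d1 d10 fd] := fu _ e10; have [d2 d20 gd] := gu _ e10.
exists (Num.min d1 d2); first by rewrite lt_min d10.
move=> n T U r /andP[r0]; rewrite lt_min => /andP[r1 r2] TU.
have -> : nc_mul f g T - nc_mul f g U =
    (f n T - f n U) *m g n T + f n U *m (g n T - g n U).
  by rewrite /nc_mul mulmxBl mulmxBr addrA subrK.
apply: (@op_boundW _ _ _ (e1 * Cg + Cf * e1)); last first.
  have -> : e = e1 * (Cf + Cg + 1) by rewrite divfK// gt_eqF.
  by rewrite (mulrC Cf) -mulrDr ler_pM2l// (addrC Cg) lerDl.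
apply: op_boundD; apply: op_boundM => //; first exact: ltW.
- by apply: fd TU; rewrite r0.
- by apply: gd TU; rewrite r0.
Qed.

Lemma A_infty_scalar (c : R[i]) : A_infty (fun n (_ : nc_ball R n) => c%:M).
Proof.
split; first split.
- by move=> n m T U W _; exact: scalar_mx_block.
- by move=> n S T U Su _; rewrite mul_mx_scalar -scalemxAl mulVmx// scalemx1.
apply/nc_unif_continuousP => e e0; exists 1 => // n T U r _ _ x.
by rewrite subrr mul0mx l2norm0 mulr_ge0 ?l2norm_ge0 ?ltW.
Qed.

Lemma A_infty_scale (c : R[i]) f : A_infty f -> A_infty (nc_scale c f).
Proof.
move=> /(A_infty_mul (A_infty_scalar c)); congr (A_infty _).
by apply: functional_extensionality_dep => n; apply/funext => T; rewrite /nc_mul mul_scalar_mx.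
Qed.

Definition coordinate (k : nat) : nc_map R := fun n T => T k.

Lemma A_infty_coordinate k : A_infty (coordinate k).
Proof.
split; first split.
- by move=> n m T U W; apply.
- by move=> n S T U _; apply.
apply/nc_unif_continuousP => e e0; exists e => // n T U r /andP[_ re] /op_bound_coord TU.
by apply: op_boundW (TU k) _; exact: ltW.
Qed.

End Ball.

(** * Means over the circle *)

Section Means.
Context {R : realType}.

Definition rmean (g : R -> R) : R :=
  (2 * pi)^-1 * \int[@lebesgue_measure R]_(t in `[0, 2 * pi]) g t.

Lemma two_pi_gt0 : 0 < 2 * pi :> R.
Proof. by rewrite mulr_gt0// pi_gt0. Qed.

Lemma integrable_circle (g : R -> R) : continuous g ->
  (@lebesgue_measure R).-integrable `[0, 2 * pi] (EFin \o g).
Proof.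
move=> cg; apply: continuous_compact_integrable; first exact: segment_compact.
exact: continuous_subspaceT.
Qed.

Lemma rmeanD (g h : R -> R) : continuous g -> continuous h ->
  rmean (fun t => g t + h t) = rmean g + rmean h.
Proof.
move=> cg ch; rewrite /rmean RintegralD//; first by rewrite mulrDr.
  exact: integrable_circle.
exact: integrable_circle.
Qed.

Lemma rmeanZ (c : R) (g : R -> R) : continuous g ->
  rmean (fun t => c * g t) = c * rmean g.
Proof.
move=> cg; rewrite /rmean RintegralZl//; first by rewrite mulrCA.
exact: integrable_circle.
Qed.

Lemma rmean_cst (c : R) : rmean (fun=> c) = c.
Proof.
rewrite /rmean Rintegral_cst//= lebesgue_measure_itv /= lte_fin two_pi_gt0.
by rewrite sube0 /= mulrCA mulVf ?mulr1// gt_eqF// two_pi_gt0.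
Qed.

Lemma rmean_le (c : R) (g : R -> R) : continuous g -> (forall t, g t <= c) ->
  rmean g <= c.
Proof.
move=> cg gc; rewrite -[leRHS]rmean_cst ler_wpM2l//.
  by rewrite invr_ge0 ltW// two_pi_gt0.
apply: le_Rintegral => //; apply: integrable_circle => //.
by move=> t; exact: cst_continuous.
Qed.

(** Continuity is imposed on the real and imaginary parts, since those are what
    [cintegral] integrates. *)
Definition ccontinuous (g : R -> R[i]) : Prop :=
  continuous (fun t => complex.Re (g t)) /\ continuous (fun t => complex.Im (g t)).

Lemma ccontinuous_cst (c : R[i]) : ccontinuous (fun=> c).
Proof. by split=> t; exact: cst_continuous. Qed.

Lemma ReD (z w : R[i]) : complex.Re (z + w) = complex.Re z + complex.Re w.
Proof. by case: z w => [a b] [c d]. Qed.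

Lemma ImD (z w : R[i]) : complex.Im (z + w) = complex.Im z + complex.Im w.
Proof. by case: z w => [a b] [c d]. Qed.

Lemma ReM (z w : R[i]) : complex.Re (z * w) =
  complex.Re z * complex.Re w - complex.Im z * complex.Im w.
Proof. by case: z w => [a b] [c d]. Qed.

Lemma ImM (z w : R[i]) : complex.Im (z * w) =
  complex.Re z * complex.Im w + complex.Im z * complex.Re w.
Proof. by case: z w => [a b] [c d]. Qed.

Lemma ccontinuousD (g h : R -> R[i]) : ccontinuous g -> ccontinuous h ->
  ccontinuous (fun t => g t + h t).
Proof.
move=> [g1 g2] [h1 h2]; split=> t.
  by under eq_fun do rewrite ReD; apply: continuousD; [exact: g1|exact: h1].
by under eq_fun do rewrite ImD; apply: continuousD; [exact: g2|exact: h2].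
Qed.

Lemma ccontinuousM (g h : R -> R[i]) : ccontinuous g -> ccontinuous h ->
  ccontinuous (fun t => g t * h t).
Proof.
move=> [g1 g2] [h1 h2]; split=> t.
  under eq_fun do rewrite ReM; apply: cvgB; apply: cvgM;
    [exact: g1|exact: h1|exact: g2|exact: h2].
under eq_fun do rewrite ImM; apply: cvgD; apply: cvgM;
  [exact: g1|exact: h2|exact: g2|exact: h1].
Qed.

Lemma ccontinuous_sum (I : finType) (g : I -> R -> R[i]) :
  (forall i, ccontinuous (g i)) -> ccontinuous (fun t => \sum_i g i t).
Proof.
move=> cg; rewrite unlock; elim: (index_enum I) => [|i s IH] /=.
  exact: ccontinuous_cst.
exact: ccontinuousD.
Qed.

Lemma ccontinuous_dist (g : R -> R[i]) :
  (forall t (e : R), 0 < e -> \forall s \near t, normc (g t - g s) <= e) ->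
  ccontinuous g.
Proof.
have ReB (z w : R[i]) : complex.Re (z - w) = complex.Re z - complex.Re w.
  by case: z w => [a b] [c d].
have ImB (z w : R[i]) : complex.Im (z - w) = complex.Im z - complex.Im w.
  by case: z w => [a b] [c d].
move=> gc; split=> t; apply/cvgrPdist_le => e e0.
  by apply: filterS (gc t e e0) => s; apply: le_trans; rewrite -ReB normc_Re.
by apply: filterS (gc t e e0) => s; apply: le_trans; rewrite -ImB normc_Im.
Qed.

Lemma ccontinuous_expi (c : R) : ccontinuous (fun t => expi (c * t)).
Proof.
split=> t /=.
  apply: (@continuous_comp _ _ _ (fun t => c * t) cos); last exact: continuous_cos.
  by apply: continuousM; [exact: cst_continuous|exact: cvg_id].
apply: (@continuous_comp _ _ _ (fun t => c * t) sin); last exact: continuous_sin.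
by apply: continuousM; [exact: cst_continuous|exact: cvg_id].
Qed.

Definition cmean (g : R -> R[i]) : R[i] :=
  ((2 * pi)^-1)%:C * cintegral `[0, 2 * pi] g.

Lemma cmeanE g : cmean g =
  rmean (fun t => complex.Re (g t)) +i* rmean (fun t => complex.Im (g t)).
Proof.
by apply/eqP; rewrite eq_complex /cmean ReM ImM /= !mul0r subr0 addr0 !eqxx.
Qed.

Lemma cmeanD g h : ccontinuous g -> ccontinuous h ->
  cmean (fun t => g t + h t) = cmean g + cmean h.
Proof.
move=> [g1 g2] [h1 h2]; rewrite !cmeanE; apply/eqP; rewrite eq_complex /=.
by rewrite -!rmeanD//; under [in X in X == _]eq_fun do rewrite ReD;
  under [in X in _ && (X == _)]eq_fun do rewrite ImD; rewrite !eqxx.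
Qed.

Lemma cmeanZ (c : R[i]) g : ccontinuous g ->
  cmean (fun t => c * g t) = c * cmean g.
Proof.
move=> [g1 g2]; rewrite !cmeanE; apply/eqP; rewrite eq_complex ReM ImM /=.
have cont (a : R) (u : R -> R) : continuous u -> continuous (fun t => a * u t).
  by move=> cu t; apply: continuousM; [exact: cst_continuous|exact: cu].
apply/andP; split; apply/eqP.
  under [in LHS]eq_fun do rewrite ReM -mulNr.
  by rewrite rmeanD ?rmeanZ ?mulNr//; exact: cont.
under [in LHS]eq_fun do rewrite ImM.
by rewrite rmeanD ?rmeanZ//; exact: cont.
Qed.

Lemma cmean_sum (I : finType) (g : I -> R -> R[i]) :
  (forall i, ccontinuous (g i)) ->
  cmean (fun t => \sum_i g i t) = \sum_i cmean (g i).
Proof.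
move=> cg; rewrite unlock.
suff H s : ccontinuous (fun t => reducebig 0 s (fun i => BigBody i +%R true (g i t))) /\
   cmean (fun t => reducebig 0 s (fun i => BigBody i +%R true (g i t))) =
   reducebig 0 s (fun i => BigBody i +%R true (cmean (g i))) by exact: (H _).2.
elim: s => [|i s [IH1 IH2]] /=.
  split; first exact: ccontinuous_cst.
  by rewrite cmeanE !rmean_cst.
by split; [exact: ccontinuousD|rewrite cmeanD// IH2].
Qed.

Lemma Re_cmean_le (c : R) g : ccontinuous g ->
  (forall t, complex.Re (g t) <= c) -> complex.Re (cmean g) <= c.
Proof. by move=> [g1 _] gc; rewrite cmeanE; exact: rmean_le. Qed.

Definition mx_mean n m (F : R -> 'M[R[i]]_(n, m)) : 'M[R[i]]_(n, m) :=
  \matrix_(i, j) cmean (fun t => F t i j).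

Definition mx_continuous n m (F : R -> 'M[R[i]]_(n, m)) : Prop :=
  forall i j, ccontinuous (fun t => F t i j).

Lemma mx_meanD n m (F G : R -> 'M[R[i]]_(n, m)) :
  mx_continuous F -> mx_continuous G ->
  mx_mean (fun t => F t + G t) = mx_mean F + mx_mean G.
Proof.
move=> cF cG; apply/matrixP => i j; rewrite !mxE -cmeanD//.
by under eq_fun do rewrite mxE.
Qed.

Lemma mx_mean0 n m : mx_mean (fun=> 0 : 'M[R[i]]_(n, m)) = 0.
Proof.
by apply/matrixP => i j; rewrite mxE; under eq_fun do rewrite mxE;
  rewrite cmeanE !rmean_cst mxE.
Qed.

Lemma mx_mean_block n1 n2 m1 m2 (A : R -> 'M[R[i]]_(n1, m1))
    (B : R -> 'M[R[i]]_(n1, m2)) (C : R -> 'M[R[i]]_(n2, m1))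
    (D : R -> 'M[R[i]]_(n2, m2)) :
  mx_mean (fun t => block_mx (A t) (B t) (C t) (D t)) =
  block_mx (mx_mean A) (mx_mean B) (mx_mean C) (mx_mean D).
Proof.
apply/matrixP => i j; rewrite -[ i ]splitK -[ j ]splitK [LHS]mxE.
case: (fintype.split i) => {}i; case: (fintype.split j) => {}j /=.
- by rewrite block_mxEul mxE; under eq_fun do rewrite block_mxEul.
- by rewrite block_mxEur mxE; under eq_fun do rewrite block_mxEur.
- by rewrite block_mxEdl mxE; under eq_fun do rewrite block_mxEdl.
- by rewrite block_mxEdr mxE; under eq_fun do rewrite block_mxEdr.
Qed.

Lemma mx_continuous_mull n m p (A : 'M[R[i]]_(p, n)) (F : R -> 'M[R[i]]_(n, m)) :
  mx_continuous F -> mx_continuous (fun t => A *m F t).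
Proof.
move=> cF i j; under eq_fun do rewrite mxE.
by apply: ccontinuous_sum => k; apply: ccontinuousM => //; exact: ccontinuous_cst.
Qed.

Lemma mx_mean_mull n m p (A : 'M[R[i]]_(p, n)) (F : R -> 'M[R[i]]_(n, m)) :
  mx_continuous F -> mx_mean (fun t => A *m F t) = A *m mx_mean F.
Proof.
move=> cF; apply/matrixP => i j; rewrite !mxE.
under eq_fun do rewrite mxE.
rewrite cmean_sum; last first.
  by move=> k; apply: ccontinuousM => //; exact: ccontinuous_cst.
by apply: eq_bigr => k _; rewrite cmeanZ// mxE.
Qed.

Lemma mx_mean_tr n m (F : R -> 'M[R[i]]_(n, m)) :
  mx_mean (fun t => (F t)^T) = (mx_mean F)^T.
Proof.
apply/matrixP => i j; rewrite !mxE.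
by under eq_fun do rewrite mxE.
Qed.

Lemma mx_mean_mulr n m p (B : 'M[R[i]]_(m, p)) (F : R -> 'M[R[i]]_(n, m)) :
  mx_continuous F -> mx_mean (fun t => F t *m B) = mx_mean F *m B.
Proof.
move=> cF; apply: trmx_inj; rewrite -mx_mean_tr trmx_mul -mx_mean_tr -mx_mean_mull.
  by under eq_fun do rewrite trmx_mul.
by move=> i j; under eq_fun do rewrite mxE; exact: cF.
Qed.

(** The entrywise integral satisfies the norm inequality of vector-valued
    integration without a factor depending on n.  With v = (mean of F) x, the
    number |v|^2 = <v, v> is the mean of <v, F(t) x>, whose real part is at most
    |v| C |x|. *)
Lemma mx_mean_op_bound n (F : R -> 'M[R[i]]_n) (C : R) : mx_continuous F ->
  (forall t, op_bound (F t) C) -> op_bound (mx_mean F) C.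
Proof.
move=> cF FC x; set v := mx_mean F *m x.
have [v0|vn0] := eqVneq (l2norm v) 0.
  by rewrite v0 (le_trans (l2norm_ge0 _) (FC 0 x)).
have vgt0 : 0 < l2norm v by rewrite lt_def vn0 l2norm_ge0.
(* Multiplying the goal by |v| turns its left-hand side into <v, v>. *)
rewrite -(ler_pM2l vgt0) -expr2 l2norm_sqr.
pose vs : 'rV[R[i]]_n := \row_j conjc (v j 0).
have normc_vs j : normc (vs 0 j) = normc (v j 0).
  by rewrite mxE; case: (v j 0) => a b; rewrite /= sqrrN.
have -> : \sum_j normc (v j 0) ^+ 2 = complex.Re ((vs *m v) 0 0).
  rewrite mxE; elim/big_rec2: _ => [//|j y z _ ->]; rewrite ReD [vs 0 j]mxE; congr (_ + _).
  by rewrite normc_sqr; case: (v j 0) => a b; rewrite ReM /= mulNr opprK -!expr2.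
have cFx : mx_continuous (fun t => F t *m x).
  move=> i j; under eq_fun do rewrite mxE.
  by apply: ccontinuous_sum => k; apply: ccontinuousM => //; exact: ccontinuous_cst.
have -> : vs *m v = mx_mean (fun t => vs *m (F t *m x)).
  by rewrite mx_mean_mull// mx_mean_mulr.
rewrite mxE; apply: Re_cmean_le.
  exact: (mx_continuous_mull vs cFx).
move=> t; apply: (@le_trans _ _ (l2norm v * l2norm (F t *m x))); last first.
  by rewrite ler_pM2l//; exact: FC.
rewrite mxE; apply: le_trans (ler_norm _) _; apply: le_trans (normc_Re _) _.
apply: le_trans (normc_sum _ _ _) _.
rewrite -ler_sqr ?nnegrE ?mulr_ge0 ?l2norm_ge0//; last first.
  by apply: sumr_ge0 => j _; exact: normc_ge0.
rewrite exprMn !l2norm_sqr.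
under eq_bigr do rewrite Normc.normcM normc_vs.
exact: sum_mul_sqr_le.
Qed.

End Means.

(** * Homogeneous components *)

Section Component.
Context {R : realType}.
Implicit Types (f : nc_map R) (k : nat).

Lemma nc_componentE f k n (T : nc_ball R n) : nc_component f k T =
  mx_mean (fun t => expi (- (k%:R * t)) *: f n (nc_rotate t T)).
Proof.
apply/matrixP => i j; rewrite !mxE -/(cmean _); congr cmean.
by apply/funext => t; rewrite mxE mulrC.
Qed.

(** The rotations of T move continuously in the row norm, since T is bounded, and f is uniformly continuous. *)
Lemma rotate_continuous f k n (T : nc_ball R n) : A_infty f ->
  mx_continuous (fun t => expi (- (k%:R * t)) *: f n (nc_rotate t T)).
Proof.
move=> [_ /nc_unif_continuousP fu] i j.
under eq_fun do rewrite mxE -mulNr.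
apply: ccontinuousM; first exact: ccontinuous_expi.
apply: ccontinuous_dist => t e e0; have [d d0 fd] := fu e e0.
have d20 : 0 < d / 4 by rewrite divr_gt0.
have := @continuous_cos R t; move=> /cvgrPdist_lt /(_ _ d20).
have := @continuous_sin R t; move=> /cvgrPdist_lt /(_ _ d20).
apply: filterS2 => s sins coss.
have st : normc (expi t - expi s) < d.
  rewrite (@le_lt_trans _ _ (`|cos t - cos s| + `|sin t - sin s|))//; last by lra.
  rewrite -ler_sqr ?nnegrE ?normc_ge0 ?addr_ge0// normc_sqr /=.
  rewrite [leRHS]sqrrD !real_normK ?num_real// lerD2r lerDl mulrn_wge0//; exact: mulr_ge0.
have [r /andP[r0 r1] Tr] := nc_ball_bound T.
suff : op_bound (f n (nc_rotate t T) - f n (nc_rotate s T)) e.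
  by move=> /(normc_le_op_bound i j); rewrite !mxE.
apply: (fd _ _ _ (normc (expi t - expi s))); first by rewrite normc_ge0.
have -> : (fun i => nc_rotate t T i - nc_rotate s T i) =
          (fun i => (expi t - expi s) *: T i).
  by apply/funext => l; rewrite scalerBl.
apply: row_boundW (row_boundZ _ Tr) _.
by rewrite ler_piMr ?normc_ge0// ltW.
Qed.

(** Each nc identity is linear in the values of f and commutes with rotation, so it
    survives averaging; the modulus of continuity survives because rotation is
    isometric and means do not increase norm bounds. *)
Lemma A_infty_component f k : A_infty f -> A_infty (nc_component f k).
Proof.
move=> Af; have := Af; move=> [[fs ft] /nc_unif_continuousP fu].
split; first split.
- move=> n m T U W WE; rewrite !nc_componentE.
  have -> : (fun t => expi (- (k%:R * t)) *: f _ (nc_rotate t W)) =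
    (fun t => block_mx (expi (- (k%:R * t)) *: f _ (nc_rotate t T)) 0 0
                       (expi (- (k%:R * t)) *: f _ (nc_rotate t U))).
    apply/funext => t; rewrite (fs _ _ (nc_rotate t T) (nc_rotate t U)).
      by rewrite scale_block_mx !scaler0.
    by move=> i; rewrite /= WE scale_block_mx !scaler0.
  by rewrite mx_mean_block !mx_mean0.
- move=> n S T U Su UE; rewrite !nc_componentE.
  have cT := rotate_continuous k T Af.
  rewrite -mx_mean_mull// -mx_mean_mulr//; last exact: mx_continuous_mull.
  congr mx_mean; apply/funext => t.
  rewrite (ft _ S (nc_rotate t T) (nc_rotate t U))//.
    by rewrite -scalemxAr -scalemxAl.
  by move=> i; rewrite /= UE -scalemxAr -scalemxAl.
apply/nc_unif_continuousP => e e0; have [d d0 fd] := fu e e0.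
exists d; first exact: d0.
move=> n T U r rd TUr.
have cT := rotate_continuous k T Af; have cU := rotate_continuous k U Af.
have cN : mx_continuous (fun t => (-1)%:M *m (expi (- (k%:R * t)) *: f n (nc_rotate t U))).
  exact: mx_continuous_mull.
have NE : - nc_component f k U =
    mx_mean (fun t => (-1)%:M *m (expi (- (k%:R * t)) *: f n (nc_rotate t U))).
  by rewrite mx_mean_mull// nc_componentE mul_scalar_mx scaleN1r.
rewrite NE nc_componentE -mx_meanD//; apply: mx_mean_op_bound.
  by move=> i j; under eq_fun do rewrite mxE; apply: ccontinuousD; [exact: cT|exact: cN].
move=> t; rewrite mul_scalar_mx scaleN1r -scalerBr.
have -> : e = normc (expi (- (k%:R * t))) * e by rewrite normc_expi mul1r.
apply: op_boundZ; apply: fd rd _.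
have -> : (fun i => nc_rotate t T i - nc_rotate t U i) =
          (fun i => expi t *: (T i - U i)).
  by apply/funext => l; rewrite scalerBr.
by have := row_boundZ (expi t) TUr; rewrite normc_expi mul1r.
Qed.

End Component.

(** * Tuples that see quadratic coefficients *)

Section Witness.
Context {R : realType}.

(** The N-th witness is a weighted directed graph on the vertices 0, ..., N + 1.
    With x_i = z_(2i) and y_i = z_(2i+1), for i < N the variable x_i is the edge
    0 -> i + 1 of weight 1 / (4 (i + 1)), written here as 1 / (2 (2i + 2)), and
    y_i is the edge i + 1 -> N + 1 of weight 1 / 2; the other variables are 0.
    So the only products of two variables that survive are the x_i y_i, which go
    from 0 to N + 1.  The weights of the edges at the vertex 0 are square
    summable, which keeps the row norm below 1 uniformly in N. *)
Definition weight (N j : nat) : R :=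
  if (j./2 < N)%N then (if odd j then 2^-1 else 2^-1 * j.+2%:R^-1) else 0.

Definition edge_source (N j : nat) : 'I_N.+2 :=
  if odd j then inord j./2.+1 else ord0.

Definition edge_target (N j : nat) : 'I_N.+2 :=
  if odd j then ord_max else inord j./2.+1.

Definition witness (N j : nat) : 'M[R[i]]_N.+2 :=
  (weight N j)%:C *: delta_mx (edge_source N j) (edge_target N j).

(** Compare with the telescoping sum of the 1/(j+1) - 1/(j+2). *)
Lemma sum_inv_sqr_le (M : nat) :
  \sum_(j < M) (j.+2%:R^-1 : R) ^+ 2 <= 1 - M.+1%:R^-1.
Proof.
elim: M => [|M IH]; first by rewrite big_ord0 invr1 subrr.
rewrite big_ord_recr /=; apply: le_trans (lerD IH (lexx _)) _.
have M0 : 0 < M.+1%:R :> R by rewrite ltr0n.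
have -> : M.+2%:R = M.+1%:R + 1 :> R by rewrite -natr1.
set x := M.+1%:R in M0 *; have x1 : 0 < x + 1 by rewrite ltr_wpDr.
have : x^-1 - (x + 1)^-1 - (x + 1)^-1 ^+ 2 = (x * (x + 1) ^+ 2)^-1.
  by field; rewrite !gt_eqF.
have : 0 <= (x * (x + 1) ^+ 2)^-1 by rewrite invr_ge0 mulr_ge0 ?sqr_ge0 ?ltW.
move: (x^-1) ((x + 1)^-1) (_^-1) => a b c; lra.
Qed.

Lemma witness_row_bound N : row_bound (witness N) 2^-1.
Proof.
apply: row_bound_delta; first by rewrite invr_ge0.
move=> p M; have [->|p0] := eqVneq p ord0.
  (* Only the edges of the x_i start at 0, but the bound may as well sum over all j. *)
  apply: (@le_trans _ _ (\sum_(j < M) 2^-1 ^+ 2 * (j.+2%:R^-1 : R) ^+ 2)).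
    rewrite big_mkcond ler_sum// => j _ /=; rewrite -exprMn.
    case: ifPn => [|_]; last exact: sqr_ge0.
    rewrite /edge_source /weight; case: ifPn => [_|_ _]; last first.
      by case: ifPn => // _; rewrite expr0n sqr_ge0.
    case: ltnP => [jN|_]; last by rewrite expr0n sqr_ge0.
    by move=> /eqP/(congr1 val); rewrite /= inordK// !ltnS ltnW.
  rewrite -mulr_sumr ler_piMr ?sqr_ge0//; apply: le_trans (sum_inv_sqr_le M) _.
  by rewrite lerBlDr lerDl invr_ge0.
(* At most one edge starts at p > 0, that of y_(p - 1), which has index 2 (p - 1) + 1. *)
apply: (@le_trans _ _ (\sum_(j < M | (j : nat) == (p.-1).*2.+1) 2^-1 ^+ 2)).
  rewrite big_mkcond [leRHS]big_mkcond ler_sum// => j _ /=.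
  case: ifPn => [|_]; last by case: ifP => // _; exact: sqr_ge0.
  rewrite /edge_source /weight; case: ifPn => [oj|_ /eqP pE]; last first.
    by rewrite -pE eqxx in p0.
  case: ltnP => [jN /eqP pE|_ _].
    have -> : (j : nat) == (p.-1).*2.+1; last by [].
    rewrite -pE inordK; last by rewrite !ltnS ltnW.
    by rewrite /= -[X in X == _]odd_double_half oj.
  by rewrite expr0n; case: ifP => // _; exact: sqr_ge0.
case: (ltnP (p.-1).*2.+1 M) => pM.
  by rewrite (big_pred1 (Ordinal pM)) // => j; rewrite -val_eqE.
rewrite big_pred0 ?sqr_ge0// => j; apply/negbTE.
by rewrite neq_ltn (leq_trans (ltn_ord j) pM).
Qed.

Lemma witness_ball_exists N : exists W : nc_ball R N.+2, W =1 witness N.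
Proof.
apply: (@nc_ball_of_bound _ _ _ 2^-1) => //; last exact: witness_row_bound.
by rewrite invr_ge0 ler0n invf_lt1// ltr1n.
Qed.

Definition witness_ball N : nc_ball R N.+2 := projT1 (cid (witness_ball_exists N)).

Lemma witness_ballE N j : witness_ball N j = witness N j.
Proof. by rewrite /witness_ball; case: cid. Qed.

Lemma witness_mul_first N j : witness N j *m (delta_mx ord0 0 : 'cV_N.+2) = 0.
Proof.
rewrite /witness /weight; case: ltnP => [jN|_]; last by rewrite scale0r mul0mx.
rewrite -scalemxAl mul_delta_mx_0 ?scaler0// /edge_target.
case: ifP => _; rewrite -val_eqE//= inordK// !ltnS; exact: ltnW.
Qed.

Lemma last_mul_witness N j : (delta_mx 0 ord_max : 'rV_N.+2) *m witness N j = 0.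
Proof.
rewrite /witness /weight; case: ltnP => [jN|_]; last by rewrite scale0r mulmx0.
rewrite -scalemxAr mul_delta_mx_0 ?scaler0// /edge_source.
case: ifP => _; rewrite -val_eqE//= inordK; first by rewrite eqSS gtn_eqF.
by rewrite !ltnS ltnW.
Qed.

Lemma witness_path N i : witness N i.*2 *m witness N i.*2.+1 =
  (if (i < N)%N then 8^-1 * i.+1%:R^-1 else 0 : R)%:C *: delta_mx ord0 ord_max.
Proof.
have halfS : (i.*2.+1)./2 = i by rewrite /= uphalf_double.
rewrite /witness /weight /edge_source /edge_target doubleK halfS oddS odd_double /=.
case: ifP => iN; last by rewrite !scale0r mul0mx.
rewrite -scalemxAl -scalemxAr mul_delta_mx scalerA -rmorphM; congr (_%:C *: _).
have -> : i.*2.+2%:R = 2 * i.+1%:R :> R by rewrite -natrM mul2n doubleS.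
have : i.+1%:R != 0 :> R by rewrite pnatr_eq0.
by move: i.+1%:R => x x0; field.
Qed.

(** A vertex at distance l from the vertex 0 gets u^l, so that conjugation by this
    diagonal multiplies every edge of the witness by u. *)
Definition grading N (u : R[i]) : 'rV[R[i]]_N.+2 :=
  \row_p (if p == ord0 then 1 else if p == ord_max then u * u else u).

Lemma witness_grading N (u : R[i]) j :
  witness N j *m diag_mx (grading N u) = diag_mx (grading N u) *m (u *: witness N j).
Proof.
rewrite /witness /weight; case: ltnP => [jN|_]; last first.
  by rewrite !scale0r scaler0 mul0mx mulmx0.
rewrite mul_mx_diag mul_diag_mx; apply/matrixP => p q; rewrite !mxE.
have [/andP[/eqP -> /eqP ->]|_] := boolP ((p == _) && (q == _)); last first.
  by rewrite !mulr0 mul0r.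
rewrite mulr1 mulrA [RHS]mulrC; congr (_ * _).
have mid0 : (inord j./2.+1 : 'I_N.+2) == ord0 = false.
  by rewrite -val_eqE /= inordK// !ltnS ltnW.
have midmax : (inord j./2.+1 : 'I_N.+2) == ord_max = false.
  by rewrite -val_eqE /= inordK ?eqSS ?ltn_eqF// !ltnS ltnW.
rewrite /edge_source /edge_target; case: (odd j).
  by rewrite mid0 midmax eqxx.
by rewrite mid0 midmax eqxx mul1r.
Qed.

End Witness.

(** * The ideal and its vanishing ideal *)

Section Ideal.
Context {R : realType}.
Implicit Types (f g : nc_map R) (c : nat -> R[i]).

Definition null_seq c : Prop :=
  forall e : R, 0 < e -> exists M, forall N, (M <= N)%N -> normc (c N) <= e.

Lemma null_seqZ (z : R[i]) c : null_seq c -> null_seq (fun N => z * c N).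
Proof.
move=> c0 e e0; have [->|zn0] := eqVneq z 0.
  by exists 0%N => N _; rewrite mul0r Normc.normc0 ltW.
have z0 : 0 < normc z.
  rewrite lt_def normc_ge0 andbT; apply/eqP => /Normc.eq0_normc/eqP.
  by rewrite (negPf zn0).
have [M cM] := c0 (e / normc z) (divr_gt0 e0 z0); exists M => N MN.
by rewrite Normc.normcM mulrC -ler_pdivlMr// cM.
Qed.

Lemma null_seqD c d : null_seq c -> null_seq d -> null_seq (fun N => c N + d N).
Proof.
move=> c0 d0 e e0; have e20 : 0 < e / 2 by rewrite divr_gt0.
have [M cM] := c0 _ e20; have [M' dM] := d0 _ e20.
exists (maxn M M') => N; rewrite geq_max => /andP[MN MN'].
by rewrite (le_trans (normcD _ _))// [e]splitr lerD ?cM ?dM.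
Qed.

Definition corner N : 'M[R[i]]_N.+2 := delta_mx ord0 ord_max.

(** All entries of f(W_N) vanish except possibly the one in the corner, which is
    c N.  Thus f has no terms of degree 0 or 1, and c N is the pairing of the
    quadratic part of f with the weights 1 / (8 (i + 1)) of the paths through
    i + 1, for i < N. *)
Definition corner_values f c : Prop := forall N, f _ (witness_ball N) = c N *: corner N.

(** The condition on the limit of c says that the quadratic part of f is orthogonal
    to the vector with coefficient 1 / (i + 1) at x_i y_i.  This vector is square
    summable but not summable. *)
Definition corner_ideal : set (nc_map R) :=
  [set f | A_infty f /\ exists2 c, corner_values f c & null_seq c].

(** The first basis vector is killed by the witness, so every value of an nc
    function acts on it as a scalar; together with the dual statement for the last
    coordinate this makes [corner_ideal] two-sided. *)
Lemma mul_corner f N : nc_function f ->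
  f _ (witness_ball N) *m corner N = value0 f *: corner N.
Proof.
move=> fnc; rewrite /corner -(mul_delta_mx (0 : 'I_1)) mulmxA.
rewrite nc_function_kernel//; first by rewrite scalemxAl.
by move=> i; rewrite witness_ballE witness_mul_first.
Qed.

Lemma corner_mul f N : nc_function f ->
  corner N *m f _ (witness_ball N) = value0 f *: corner N.
Proof.
move=> fnc; rewrite /corner -(mul_delta_mx (0 : 'I_1)) -mulmxA.
rewrite nc_function_cokernel//; first by rewrite scalemxAr.
by move=> i; rewrite witness_ballE last_mul_witness.
Qed.

Lemma corner_ideal_ideal : nc_ideal corner_ideal.
Proof.
split.
- by move=> f [].
- split; first exact: A_infty_zero.
  exists (fun=> 0); first by move=> N; rewrite scale0r.
  by move=> e e0; exists 0%N => N _; rewrite Normc.normc0 ltW.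
- move=> f g [Af [c fc c0]] [Ag [d gd d0]]; split; first exact: A_infty_add.
  exists (fun N => c N + d N); last exact: null_seqD.
  by move=> N; rewrite /nc_add fc gd scalerDl.
- move=> z f [Af [c fc c0]]; split; first exact: A_infty_scale.
  exists (fun N => z * c N); last exact: null_seqZ.
  by move=> N; rewrite /nc_scale fc scalerA.
- move=> a f Aa [Af [c fc c0]]; split; first exact: A_infty_mul.
  exists (fun N => value0 a * c N); last exact: null_seqZ.
  move=> N; rewrite /nc_mul fc -scalemxAr mul_corner; last exact: Aa.1.
  by rewrite scalerA mulrC.
- move=> a f Aa [Af [c fc c0]]; split; first exact: A_infty_mul.
  exists (fun N => value0 a * c N); last exact: null_seqZ.
  move=> N; rewrite /nc_mul fc -scalemxAl corner_mul; last exact: Aa.1.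
  by rewrite scalerA mulrC.
Qed.

Lemma corner_ideal_closed : nc_closed corner_ideal.
Proof.
move=> f Af fJ; split=> //.
have approx (e : R) : 0 < e -> exists2 g, corner_ideal g &
    forall N p q, normc (f _ (witness_ball N) p q - g _ (witness_ball N) p q) <= e.
  move=> e0; have [g Jg fg] := fJ e e0; exists g => // N p q.
  have /opnorm_ltP[r /andP[_ re] fgr] :
      (opnorm (nc_sub f g (witness_ball N)) < e%:E)%E.
    by apply: le_lt_trans fg; apply: ereal_sup_ubound; exists N.+2, (witness_ball N).
  have := normc_le_op_bound p q fgr; rewrite /nc_sub !mxE => /le_trans; apply.
  exact: ltW.
exists (fun N => f _ (witness_ball N) ord0 ord_max).
  move=> N; apply/matrixP => p q; rewrite !mxE.
  have [/andP[/eqP -> /eqP ->]|pq] := boolP ((p == _) && (q == _)).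
    by rewrite mulr1.
  rewrite mulr0; apply: Normc.eq0_normc; apply/eqP; rewrite eq_le normc_ge0 andbT.
  (* Outside the corner, the approximants vanish. *)
  apply/ler_addgt0Pr => e e0; rewrite add0r; have [g [_ [c gc _]] fg] := approx e e0.
  by have := fg N p q; rewrite gc !mxE (negPf pq) mulr0 subr0.
move=> e e0; have e20 : 0 < e / 2 by rewrite divr_gt0.
have [g [_ [c gc c0]] fg] := approx _ e20.
have [M cM] := c0 _ e20; exists M => N MN; have := fg N ord0 ord_max.
rewrite gc !mxE !eqxx mulr1 => fcN.
rewrite -[X in normc X](subrK (c N)) (le_trans (normcD _ _))// [e]splitr.
by rewrite lerD// cM.
Qed.

(** The corner entry sits at the end of the paths of length 2, so rotation
    multiplies it by the square of e^(it). *)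
Lemma corner_values_rotate f c t N : nc_function f -> corner_values f c ->
  f _ (nc_rotate t (witness_ball N)) = (expi t * expi t) *: (c N *: corner N).
Proof.
move=> fnc fc; set u := expi t.
have u0 : u != 0.
  apply/eqP => /(congr1 (@normc R)); rewrite normc_expi Normc.normc0 => /eqP.
  by rewrite oner_eq0.
have := @nc_function_intertwine _ f _ _ (witness_ball N)
  (nc_rotate t (witness_ball N)) (diag_mx (grading N u)) fnc.
rewrite fc => H.
have {H}/matrixP H : (c N *: corner N) *m diag_mx (grading N u) =
    diag_mx (grading N u) *m f _ (nc_rotate t (witness_ball N)).
  by apply: H => i; rewrite /= !witness_ballE witness_grading.
apply/matrixP => p q; have := H p q.
have gp0 : grading N u 0 p != 0.
  by rewrite mxE; case: ifP => _; [rewrite oner_eq0|case: ifP; rewrite ?mulf_neq0].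
rewrite mul_mx_diag mul_diag_mx mxE [X in _ = X -> _]mxE => E.
apply: (mulfI gp0); rewrite -E !mxE.
have [/andP[/eqP -> /eqP ->]|_] := boolP ((p == _) && (q == _)).
  by rewrite !eqxx /= !mulr1 mul1r mulrC.
by rewrite !mulr0 mul0r.
Qed.

Lemma corner_ideal_homogeneous : nc_homogeneous corner_ideal.
Proof.
move=> f [Af [c fc c0]] k; split; first exact: A_infty_component.
pose kappa : R[i] := cmean (fun t => expi (- (k%:R * t)) * (expi t * expi t)).
exists (fun N => kappa * c N); last exact: null_seqZ.
have cexp : ccontinuous (fun t => expi (- (k%:R * t)) * (expi t * expi t) : R[i]).
  have c1 : ccontinuous (fun t => expi t : R[i]).
    by have := ccontinuous_expi (1 : R); under eq_fun do rewrite mul1r.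
  apply: ccontinuousM; last exact: ccontinuousM.
  by under eq_fun do rewrite -mulNr; exact: ccontinuous_expi.
move=> N; rewrite nc_componentE.
under eq_fun do rewrite (corner_values_rotate _ _ Af.1 fc).
apply/matrixP => p q; rewrite !mxE.
have -> : (fun t => (expi (- (k%:R * t)) *:
    ((expi t * expi t) *: (c N *: corner N))) p q) =
  (fun t => (c N * corner N p q) * (expi (- (k%:R * t)) * (expi t * expi t))).
  by apply/funext => t; rewrite !mxE; ring.
by rewrite cmeanZ// -/kappa !mxE; ring.
Qed.

(** The monomial x_i y_i. *)
Definition path_product (i : nat) : nc_map R := nc_mul (coordinate i.*2) (coordinate i.*2.+1).

Lemma A_infty_path_product i : A_infty (path_product i).
Proof. by apply: A_infty_mul; exact: A_infty_coordinate. Qed.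

Lemma path_product_corner i : corner_values (path_product i)
  (fun N => (if (i < N)%N then 8^-1 * i.+1%:R^-1 else 0 : R)%:C).
Proof. by move=> N; rewrite /path_product /nc_mul /coordinate !witness_ballE witness_path. Qed.

Definition path_relation (i : nat) : nc_map R :=
  nc_add (path_product 0) (nc_scale (- i.+1%:R) (path_product i)).

Lemma path_relation_in i : corner_ideal (path_relation i).
Proof.
split.
  apply: A_infty_add; first exact: A_infty_path_product.
  by apply: A_infty_scale; exact: A_infty_path_product.
exists (fun N => (if (0 < N)%N then 8^-1 * 1%:R^-1 else 0 : R)%:C +
  - i.+1%:R * (if (i < N)%N then 8^-1 * i.+1%:R^-1 else 0 : R)%:C).
  move=> N; rewrite /path_relation /nc_add /nc_scale !path_product_corner.
  by rewrite scalerA scalerDl.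
(* From N = i + 1 on, the witness sees both x_0 y_0 and x_i y_i, whose corner entries 1/8 and 1 / (8 (i + 1)) cancel. *)
move=> e e0; exists i.+1 => N iN; rewrite iN (leq_trans _ iN)//.
rewrite -(rmorph_nat (real_complex R)) -rmorphN -rmorphM -rmorphD.
have -> : 8^-1 * 1%:R^-1 + - i.+1%:R * (8^-1 * i.+1%:R^-1) = 0 :> R.
  have : i.+1%:R != 0 :> R by rewrite pnatr_eq0.
  by move: i.+1%:R => x x0; field.
by rewrite Normc.normc0 ltW.
Qed.

Lemma path_product_notin : ~ corner_ideal (path_product 0).
Proof.
(* The corner entry of x_0 y_0 is 1/8 for all N > 0. *)
move=> [_ [c pc c0]]; have e0 : 0 < 16^-1 :> R by rewrite invr_gt0.
have [M cM] := c0 _ e0; have := cM M.+1 (leqnSn _).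
have := path_product_corner 0 M.+1; rewrite pc => /matrixP /(_ ord0 ord_max).
rewrite !mxE !eqxx !mulr1 => ->; rewrite normc_real invr1 mulr1.
by rewrite ger0_norm ?invr_ge0// lef_pV2 ?posrE// ler_nat.
Qed.

(** Apply the row operator to the vectors conj((T_j)_(p q)) e_q. *)
Lemma row_bound_entries n (T : nat -> 'M[R[i]]_n) p q (M : nat) :
  row_bound T 1 -> \sum_(j < M) normc (T j p q) ^+ 2 <= 1.
Proof.
move=> T1; set s := \sum_(j < M) _.
have s0 : 0 <= s by apply: sumr_ge0 => j _; exact: sqr_ge0.
pose x j : 'cV[R[i]]_n := conjc (T j p q) *: delta_mx q 0.
have conjN z : normc (conjc z) = normc z :> R.
  by case: z => a b; rewrite /= sqrrN.
have xs : seq_norm M x ^+ 2 = s.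
  rewrite seq_norm_sqr; apply: eq_bigr => j _.
  by rewrite l2normZ l2norm_delta mulr1 conjN.
have sx : s <= seq_norm M x.
  have := T1 M x; rewrite mul1r; apply: le_trans.
  apply: le_trans (normc_le_l2norm _ p); rewrite summxE.
  have -> : \sum_(j < M) (T j *m x j) p 0 = s%:C.
    rewrite rmorph_sum; apply: eq_bigr => j _.
    rewrite -scalemxAr -colE !mxE normc_sqr; case: (T j p q) => a b.
    by apply/eqP; rewrite eq_complex /=; apply/andP; split; apply/eqP; ring.
  by rewrite normc_real ler_norm.
have : seq_norm M x ^+ 2 <= seq_norm M x by rewrite xs.
rewrite expr2 => xx; have [x0|x0] := eqVneq (seq_norm M x) 0.
  by rewrite -xs x0 expr0n ler01.
have xgt0 : 0 < seq_norm M x by rewrite lt_def x0 seq_norm_ge0.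
move: xx; rewrite ger_pMl// => x1; rewrite -xs expr_le1//; exact: ltW.
Qed.

Lemma sum_pairs (F : nat -> R) (M : nat) :
  \sum_(j < M.*2) F j = \sum_(i < M) (F i.*2 + F i.*2.+1).
Proof.
elim: M => [|M IH]; first by rewrite !big_ord0.
by rewrite doubleS !big_ord_recr /= IH addrA.
Qed.

(** Otherwise the partial sums of the harmonic series would be bounded by C / a. *)
Lemma harmonic_unbounded (a C : R) : 0 <= a ->
  (forall M, \sum_(i < M) a / i.+1%:R <= C) -> a = 0.
Proof.
move=> a0 aC; apply/eqP; apply: contraT => an0; exfalso.
have agt0 : 0 < a by rewrite lt_def an0.
apply: (@dvg_harmonic R); apply: nondecreasing_is_cvgn.
  by apply: nondecreasing_series => i _ _; exact: harmonic_ge0.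
exists (C / a) => _ [M _ <-]; rewrite ler_pdivlMr// mulrC /series /=.
by rewrite big_mkord mulr_sumr; exact: aC.
Qed.

(** On the zero locus, X_0 Y_0 = (i + 1) X_i Y_i for all i, so each entry z of
    X_0 Y_0 satisfies |z| / (i + 1) <= the modulus of an entry of X_i Y_i.
    The latter is summable over i, as a sum of n products of square summable
    sequences, where n is the size of T; so divergence of the harmonic
    series forces z = 0. *)
Lemma path_product_vanishes n (T : nc_ball R n) :
  zero_locus corner_ideal T -> path_product 0 T = 0.
Proof.
move=> TV; have [r /andP[r0 r1] Tr] := nc_ball_bound T.
have T1 : row_bound T 1 by apply: row_boundW Tr _; exact: ltW.
have rel i : path_product 0 T = i.+1%:R *: path_product i T.
  have /eqP := TV _ (path_relation_in i).
  by rewrite /path_relation /nc_add /nc_scale scaleNr subr_eq0 => /eqP.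
apply/matrixP => p q; rewrite [RHS]mxE; apply: Normc.eq0_normc.
apply: (@harmonic_unbounded _ (\sum_(k < n) (1 + 1))); first exact: normc_ge0.
move=> M; apply: (@le_trans _ _ (\sum_(i < M) \sum_(k < n)
    (normc (T i.*2 p k) ^+ 2 + normc (T i.*2.+1 k q) ^+ 2))).
  apply: ler_sum => i _; rewrite (rel i) mxE Normc.normcM.
  rewrite -(rmorph_nat (real_complex R)) normc_real ger0_norm// mulrC mulKf ?pnatr_eq0//.
  rewrite /path_product /nc_mul /coordinate mxE; apply: le_trans (normc_sum _ _ _) _.
  apply: ler_sum => k _; rewrite Normc.normcM.
  have := sqr_ge0 (normc (T i.*2 p k) - normc (T i.*2.+1 k q)).
  have := mulr_ge0 (normc_ge0 (T i.*2 p k)) (normc_ge0 (T i.*2.+1 k q)).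
  by rewrite sqrrB; lra.
rewrite exchange_big; apply: ler_sum => k _ /=; rewrite big_split /=.
apply: lerD; [apply: le_trans (row_bound_entries p k M.*2 T1)|
  apply: le_trans (row_bound_entries k q M.*2 T1)].
  rewrite (sum_pairs (fun j => normc (T j p k) ^+ 2)) ler_sum// => i _.
  by rewrite lerDl sqr_ge0.
rewrite (sum_pairs (fun j => normc (T j k q) ^+ 2)) ler_sum// => i _.
by rewrite lerDr sqr_ge0.
Qed.

End Ideal.

Theorem proposition3p8 (R : realType) :
  exists J : set (nc_map R),
    [/\ nc_ideal J, nc_closed J, nc_homogeneous J
      & J `<` vanishing_ideal (zero_locus J)].
Proof.
exists corner_ideal; split.
- exact: corner_ideal_ideal.
- exact: corner_ideal_closed.
- exact: corner_ideal_homogeneous.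
split=> [f Jf|VJ].
  by split=> [|n T]; [case: Jf|exact].
apply: path_product_notin; apply: VJ; split; first exact: A_infty_path_product.
exact: path_product_vanishes.
Qed.
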